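(* Let $k$ be a positive integer, let $G$ be a balanced bipartite graph of order $2n$, and let $M$ be a perfect matching of $G$, where $n \ge 12k-9$. If $\sigma_{1,1}(G) \ge n+2$, then $G$ contains $k$ vertex-disjoint $M$-cycles, each of length $6$ or $8$.
   Context: Graphs are finite and simple. For a bipartite graph $G$ with partite sets $X,Y$, $\sigma_{1,1}(G) = \min\{d_G(x)+d_G(y) : x \in X, y \in Y, xy \notin E(G)\}$ if $G$ is not complete bipartite, and $+\infty$ otherwise. For a matching $M$, a cycle $C$ of $G$ is an $M$-cycle if $|E(C)\cap M| = |C|/2$, i.e. $C$ alternates between edges of $M$ and edges not in $M$. *)

(* Defs.v *)
From mathcomp Require Import all_boot.
Set Implicit Arguments. Unset Strict Implicit. Unset Printing Implicit Defensive.

Definition simple_graph (T : finType) (e : rel T) : Prop :=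
  symmetric e /\ irreflexive e.

Definition deg (T : finType) (e : rel T) (x : T) : nat := #|[set y | e x y]|.

Definition bipartite_with (T : finType) (e : rel T) (X : {set T}) : Prop :=
  forall x y, e x y -> (x \in X) = (y \notin X).

(* sigma_{1,1}(G) >= s, where sigma_{1,1}(G) is the minimum of d(x)+d(y)
   over non-adjacent x in X, y in Y (and +oo if G is complete bipartite). *)
Definition sigma11_ge (T : finType) (e : rel T) (X : {set T}) (s : nat) : Prop :=
  forall x y, x \in X -> y \notin X -> ~~ e x y -> s <= deg e x + deg e y.

Definition perfect_matching (T : finType) (e : rel T) (M : {set {set T}}) : Prop :=
  (forall A, A \in M -> exists x y, e x y /\ A = [set x; y]) /\
  (forall v, #|[set A in M | v \in A]| = 1).

Definition is_cycle (T : finType) (e : rel T) (c : seq T) : Prop :=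
  uniq c /\ 3 <= size c /\ cycle e c.

Definition cycle_edges (T : finType) (c : seq T) : seq {set T} :=
  [seq [set x; next c x] | x <- c].

Definition M_cycle (T : finType) (e : rel T) (M : {set {set T}}) (c : seq T) : Prop :=
  is_cycle e c /\ count (fun A => A \in M) (cycle_edges c) = size c %/ 2.

(* Main.v *)
Require Import Defs.
From mathcomp Require Import all_boot zify.
From Stdlib Require Import Classical.
Set Implicit Arguments. Unset Strict Implicit. Unset Printing Implicit Defensive.

(** Contracting the perfect matching turns [G] into a digraph [D] on [X], with
    [u -> v] when [u] is adjacent to the mate of [v]: [M]-cycles of length [2l] are
    the directed [l]-cycles of [D], and non-arcs [u -> v] satisfy
    [d+(u) + d-(v) >= n]. Let [W] be the vertex set of a maximal packing of
    directed 3- and 4-cycles, and suppose that it has fewer than [k] of them. The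
    rest [H] is free of such cycles and [|H| >= 8k - 5]. Call a path [a -> b -> c]
    in [H] good if the degrees within [H] satisfy [d+(c) + d-(a) <= |H| - k]. By
    the degree condition at least [k] vertices [w] of [W] then satisfy
    [c -> w -> a], so [k] disjoint good paths close up greedily to [k] disjoint
    4-cycles.

    To find them, let [U] be the vertex set of a maximal packing of good paths and
    [R = H \ U]. If [R] contains a path on three vertices, it contains a good one:
    otherwise, along each such path, the out-neighbours of the end and the
    in-neighbours of the start nearly partition [H], which forces out-degrees
    above one half inside some out-neighbourhood or in-degrees above one half
    inside some in-neighbourhood, impossible without 3-cycles. If [R] contains no
    such path, it induces disjoint 2-cycles and isolated vertices, and every
    non-arc [u -> v] of [R] is bridged by [k] vertices [x] of [U], giving good
    paths [u -> x -> v]. *)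

(** * Neighbourhoods, greedy packings and low out-degrees *)

Definition outs (V : finType) (e : rel V) (S : {set V}) (u : V) : {set V} :=
  [set v in S | e u v].
Definition ins (V : finType) (e : rel V) (S : {set V}) (v : V) : {set V} :=
  [set u in S | e u v].

Definition free3 (V : finType) (e : rel V) (S : {set V}) : Prop :=
  forall a b c, a \in S -> b \in S -> c \in S -> e a b -> e b c -> ~~ e c a.
(** The inequalities exclude closed walks along 2-cycles, which remain allowed; for three vertices
    irreflexivity already gives distinctness. *)
Definition free4 (V : finType) (e : rel V) (S : {set V}) : Prop :=
  forall a b c d, a \in S -> b \in S -> c \in S -> d \in S ->
    a != c -> b != d -> e a b -> e b c -> e c d -> ~~ e d a.

(** Uniqueness of the flattened list makes the members both repetition-free and pairwise
    disjoint. *)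
Definition packing (V : finType) (P : seq V -> Prop) (k : nat) (L : seq (seq V)) : Prop :=
  [/\ size L = k, forall s, s \in L -> P s & uniq (flatten L)].

Lemma greedy_packing (V : finType) (P : seq V -> Prop) (k : nat) :
  (forall j L, j < k -> packing P j L ->
     exists s, [/\ P s, uniq s & forall x, x \in s -> x \notin flatten L]) ->
  exists L, packing P k L.
Proof.
move=> ext; have: forall j, j <= k -> exists L, packing P j L; last by apply.
elim=> [|j IHj] jk; first by exists [::].
have [L pL] := IHj (ltnW jk); have [s [Ps us sL]] := ext j L jk pL.
case: pL => zL PL uL; exists (s :: L); split=> /=; first by rewrite zL.
  by move=> t /predU1P[->|/PL].
rewrite cat_uniq us uL andbT; apply/hasPn=> x xL.
by apply/negP=> /sL; rewrite xL.
Qed.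

(** If [k] members are out of reach, greedy extension gets stuck at some [j < k], and a stuck
    packing meets every candidate. *)
Lemma maximal_packing (V : finType) (P : seq V -> Prop) (k : nat) :
  (exists L, packing P k L) \/
  exists j L, [/\ j < k, packing P j L &
    forall s, P s -> uniq s -> exists2 x, x \in s & x \in flatten L].
Proof.
case: (classic (exists L, packing P k L)) => [|npk]; [by left | right].
apply: NNPP => nmax; apply: npk; apply: greedy_packing => j L jk pL.
apply: NNPP => next; apply: nmax; exists j, L; split=> // s Ps us.
case: (boolP (has (mem (flatten L)) s)) => [/hasP[x xs xL]|/hasPn sL]; first by exists x.
by exfalso; apply: next; exists s; split.
Qed.

Lemma size_flatten_packing (V : finType) (P : seq V -> Prop) (k m : nat)
    (L : seq (seq V)) :
  packing P k L -> (forall s, P s -> size s <= m) ->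
  #|[set x in flatten L]| <= m * k.
Proof.
case=> <- PL _ Pm; rewrite cardsE (leq_trans (card_size _)) // size_flatten.
elim: L PL => [|s L IHL] PL /=; first by rewrite muln0.
rewrite mulnS; apply: leq_add; first by apply: Pm; apply: PL; rewrite mem_head.
by apply: IHL => t tL; apply: PL; rewrite inE tL orbT.
Qed.

(** Each member has [k] candidates in [Z], of which the others occupy fewer than [k]. [perm_eq] lets
    the new vertex enter at any position. *)
Lemma extend_packing (V : finType) (P Q : seq V -> Prop) (Z : {set V}) (k : nat)
    (L : seq (seq V)) :
  packing P k L ->
  (forall s x, P s -> x \in s -> x \notin Z) ->
  (forall s, P s -> exists Y : {set V}, [/\ Y \subset Z, k <= #|Y| &
     forall x, x \in Y -> exists2 t, perm_eq t (x :: s) & Q t]) ->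
  exists L', packing Q k L'.
Proof.
case=> zL PL uL PZ PY.
(* The induction also records that at most one vertex of [Z] is spent per member. *)
have: exists L', [/\ packing Q (size L) L', {subset flatten L' <= [predU Z & flatten L]}
    & #|[set x in flatten L' | x \in Z]| <= size L].
  have {zL}: size L <= k by rewrite zL.
  elim: L PL uL => [|s L IHL] PL uL zL.
    exists [::]; split=> //=.
    by rewrite leqn0 cards_eq0; apply/eqP/setP=> x; rewrite !inE.
  move: uL; rewrite /= cat_uniq => /and3P[us /hasPn dsL uL].
  have Ps : P s by apply: PL; rewrite mem_head.
  have PL' t : t \in L -> P t by move=> tL; apply: PL; rewrite inE tL orbT.
  have [|L' [[zL' QL' uL'] sL' cL']] := IHL PL' uL; first exact: ltnW.
  have [Y [YZ cY Yt]] := PY s Ps.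
  have /subsetPn[x xY xL'] : ~~ (Y \subset [set x in flatten L' | x \in Z]).
    by apply/negP=> /subset_leq_card; rewrite leqNgt (leq_ltn_trans cL' (leq_trans zL cY)).
  have xZ : x \in Z by exact: subsetP YZ x xY.
  have {}xL' : x \notin flatten L' by move: xL'; rewrite inE xZ andbT.
  have [t pt Qt] := Yt x xY; exists (t :: L'); split=> /=.
  - split=> /=; first by rewrite zL'.
      by move=> r /predU1P[->|/QL'].
    rewrite cat_uniq uL' (perm_uniq pt) /= us !andbT.
    rewrite (contraL (PZ s x Ps)) //=.
    apply/hasPn=> y yL' /=; rewrite (perm_mem pt) inE negb_or.
    apply/andP; split; first by apply: contraNneq xL' => <-.
    have := sL' y yL'; rewrite !inE => /orP[yZ|/dsL //].
    by apply/negP => /(PZ s y Ps); rewrite yZ.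
  - move=> y; rewrite mem_cat (perm_mem pt) !inE mem_cat -orbA.
    case/or3P => [/eqP->|->|/sL']; rewrite ?xZ ?orbT //.
    by rewrite !inE => /orP[->|->]; rewrite ?orbT.
  - rewrite (leq_trans (subset_leq_card (_ : _ \subset x |: [set x in flatten L' | x \in Z]))) //.
      apply/subsetP=> y; rewrite !inE mem_cat (perm_mem pt) inE -orbA => /andP[+ yZ].
      case/or3P => [->//|/(PZ s y Ps)|->]; first by rewrite yZ.
      by rewrite yZ orbT.
    by rewrite cardsU1 -[(size L).+1]add1n leq_add ?leq_b1.
by case=> L' [pL' _ _]; exists L'; rewrite -zL.
Qed.

(* Choose [x] with [d+(x) <= d-(x)]. If [x] lies on no 2-cycle then [x] works;
   if [x <-> y], the out-neighbours of [y] and in-neighbours of [x] are disjoint,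
   so [x] or [y] works. *)
Lemma exists_low_outdegree (V : finType) (e : rel V) (S : {set V}) :
  free3 e S -> S != set0 -> exists2 u, u \in S & 2 * #|outs e S u| <= #|S|.
Proof.
move=> f3 /set0Pn[x0 x0S].
have [x xS le_x] : exists2 x, x \in S & #|outs e S x| <= #|ins e S x|.
  apply/exists_inP; rewrite -[X in is_true X]negbK negb_exists_in; apply/negP => /forall_inP lt.
  (* Both sums count the arcs inside [S], so out-degrees cannot exceed in-degrees everywhere. *)
  have: \sum_(x in S) #|outs e S x| = \sum_(x in S) #|ins e S x|.
    under eq_bigr do rewrite -sum1dep_card big_mkcondr.
    rewrite exchange_big; apply: eq_bigr => x _.
    by rewrite -sum1dep_card [RHS]big_mkcondr.
  apply/eqP; rewrite gtn_eqF // (bigD1 x0) //= [ltnRHS](bigD1 x0) //=.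
  have := lt x0 x0S; rewrite -ltnNge => lt0.
  by rewrite -addSn leq_add //; apply: leq_sum => x /andP[/lt]; rewrite -ltnNge => /ltnW.
have disj y : y \in S -> #|outs e S y :&: ins e S x| = 0 -> #|outs e S y| + #|ins e S x| <= #|S|.
  move=> yS z0; rewrite -cardsUI z0 addn0 subset_leq_card // subUset.
  by apply/andP; split; apply/subsetP=> z; rewrite inE => /andP[].
case: (boolP [exists y in S, e x y && e y x]) => [/exists_inP[y yS /andP[exy eyx]]|].
  have := disj y yS; rewrite (_ : _ :&: _ = set0) ?cards0.
    move=> /(_ erefl) le_yx; case: (leqP (2 * #|outs e S y|) #|S|) => ?; first by exists y.
    by exists x => //; lia.
  apply/setP=> z; rewrite !inE; apply/negP=> /andP[/andP[zS eyz] /andP[_ ezx]].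
  by have := f3 y z x yS zS xS eyz ezx; rewrite exy.
move=> /exists_inPn n2; exists x => //; have := disj x xS; rewrite (_ : _ :&: _ = set0) ?cards0.
  by move=> /(_ erefl); lia.
apply/setP=> z; rewrite !inE; apply/negP=> /andP[/andP[zS exz] /andP[_ ezx]].
by have := n2 z zS; rewrite exz ezx.
Qed.

(** * Paths on three vertices in the absence of 3- and 4-cycles *)

Definition path3 (V : finType) (e : rel V) (S : {set V}) (a b c : V) : bool :=
  [&& uniq [:: a; b; c], all (mem S) [:: a; b; c], e a b & e b c].

(** Reversal turns [outs] into [ins] by conversion, so results on out-degrees transfer to
    in-degrees. *)
Definition revrel (V : finType) (e : rel V) : rel V := fun x y => e y x.

Lemma path3P (V : finType) (e : rel V) (S : {set V}) (a b c : V) :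
  reflect ([/\ a != b, a != c & b != c] /\ [/\ a \in S, b \in S, c \in S, e a b & e b c])
          (path3 e S a b c).
Proof.
rewrite /path3 /= !inE !andbT negb_or.
by apply: (iffP idP) => [/and4P[/andP[/andP[-> ->] ->] /and3P[-> -> ->] -> ->]|[[-> -> ->] [-> -> -> -> ->]]].
Qed.

Lemma path3_rev (V : finType) (e : rel V) (S : {set V}) (a b c : V) :
  path3 (revrel e) S a b c = path3 e S c b a.
Proof.
by apply/path3P/path3P => -[[? ? ?] [? ? ? ? ?]]; split; split=> //; rewrite eq_sym.
Qed.

Lemma free3_rev (V : finType) (e : rel V) (S : {set V}) : free3 e S -> free3 (revrel e) S.
Proof. by move=> f3 a b c aS bS cS eba ecb; apply: (f3 c b a). Qed.

Lemma free4_rev (V : finType) (e : rel V) (S : {set V}) : free4 e S -> free4 (revrel e) S.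
Proof.
by move=> f4 a b c d aS bS cS dS ac bd eba ecb edc; apply: (f4 d c b a); rewrite // eq_sym.
Qed.

Lemma free3_disjoint (V : finType) (e : rel V) (S : {set V}) (a b : V) :
  free3 e S -> a \in S -> b \in S -> e a b -> [disjoint outs e S b & ins e S a].
Proof.
move=> f3 aS bS eab; rewrite disjoint_subset; apply/subsetP=> z.
rewrite !inE => /andP[zS ebz]; rewrite zS /=; exact: f3 eab ebz.
Qed.

(** Any other common vertex [z] would close the 4-cycle [a -> b -> c -> z -> a]. *)
Lemma free34_inter (V : finType) (e : rel V) (S : {set V}) (a b c : V) :
  irreflexive e -> free3 e S -> free4 e S -> path3 e S a b c ->
  outs e S c :&: ins e S a \subset [set b].
Proof.
move=> irr f3 f4 /path3P[[ab ac bc] [aS bS cS eab ebc]]; apply/subsetP=> z.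
rewrite !inE => /andP[/andP[zS ecz] /andP[_]]; apply: contraTT => zb.
by apply: (f4 a b c z); rewrite // eq_sym.
Qed.

(* Along a path [b -> c -> u], the sets of out-neighbours of [u] and of
   in-neighbours of [b] almost partition [H]; as the out-neighbours of [c] avoid
   the latter, nearly all of them are out-neighbours of [u]. *)
Lemma card_outs_le (V : finType) (e : rel V) (H R : {set V}) (k : nat) (b c : V) :
  irreflexive e -> free3 e H -> free4 e H -> R \subset H -> 0 < k ->
  (forall x y z, path3 e R x y z -> #|H| < k + (#|outs e H z| + #|ins e H x|)) ->
  b \in R -> c \in R -> e b c -> #|outs e R c| < 2 * k.
Proof.
move=> irr f3 f4 /subsetP RH k0 bad bR cR ebc.
have bc : b != c by apply: contraTneq ebc => ->; rewrite irr.
(* [c -> b] may hold, but the path [b -> c -> u] needs [u != b]. *)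
pose S := outs e R c :\ b.
suff: #|S| + 2 <= 2 * k.
  by rewrite (cardsD1 b (outs e R c)) -/S; case: (_ \in _); lia.
have [->|S0] := eqVneq S set0; first by rewrite cards0; lia.
have SH x : x \in S -> x \in H by rewrite !inE => /and3P[_ /RH].
have fS : free3 e S by move=> x y z /SH xH /SH yH /SH zH; apply: f3.
have [u uS le_u] := exists_low_outdegree fS S0.
have /setD1P[ub] := uS; rewrite inE => /andP[uR ecu].
have cu : c != u by apply: contraTneq ecu => ->; rewrite irr.
have pbcu : path3 e R b c u by apply/path3P; rewrite bc cu eq_sym ub.
have pH : path3 e H b c u by apply/path3P; rewrite bc cu eq_sym ub !RH.
have := subset_leq_card (free34_inter irr f3 f4 pH); rewrite cards1 => le1.
have lt_bad := bad b c u pbcu.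
have cH := RH c cR; have bH := RH b bR; have uH := RH u uR.
(* The union of the two neighbourhoods has at least [#|H| - k] vertices, as they share at most [c].
   Outside it lie [b] and all of [S :\: outs e H u], so [u] misses at most [k - 1] vertices of [S],
   yet at least half of them. *)
have dis : [disjoint outs e H u :|: ins e H b & b |: (S :\: outs e H u)].
  rewrite disjoint_subset; apply/subsetP=> z; rewrite !inE => zub; apply/negP.
  case/predU1P => [zb|/andP[nuz /and3P[zb zR ecz]]]; case/orP: zub => /andP[zH ez].
  - by have := f3 b c u bH cH uH ebc ecu; rewrite -zb ez.
  - by move: ez; rewrite zb irr.
  - by rewrite zH ez in nuz.
  - by have := f3 b c z bH cH zH ebc ecz; rewrite ez.
have bS : b \notin S :\: outs e H u by rewrite !inE eqxx andbF.
have sub : (outs e H u :|: ins e H b) :|: (b |: (S :\: outs e H u)) \subset H.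
  rewrite !subUset sub1set bH; apply/andP; split; last first.
    by apply/subsetP=> z; rewrite inE => /andP[_ /SH].
  by apply/andP; split; apply/subsetP=> z; rewrite inE => /andP[].
have := subset_leq_card sub.
rewrite cardsU (disjoint_setI0 dis) cards0 subn0 cardsU1 bS add1n.
have := cardsUI (outs e H u) (ins e H b).
have : #|S| = #|outs e S u| + #|S :\: outs e H u|.
  rewrite -(cardsID (outs e H u) S); congr (#|pred_of_set _| + _).
  apply/setP=> z; rewrite [in RHS]inE [in LHS]inE; case zS : (z \in S) => //=.
  by rewrite inE (SH z zS).
move: lt_bad le1 le_u k0; clear; clearbody S; lia.
Qed.

(** If no path in [H :\: U] were good, [c] would have at most [2 * k - 1] out-neighbours there and
    [a] as many in-neighbours; their traces on [U] are disjoint and add at most [3 * (k - 1)]. The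
    total [7 * k - 5] is at most [#|H| - k], a contradiction. *)
Lemma exists_good_path3 (V : finType) (e : rel V) (H U : {set V}) (k : nat) (a b c : V) :
  irreflexive e -> free3 e H -> free4 e H -> U \subset H -> 0 < k ->
  #|U| <= 3 * (k - 1) -> 8 * k - 5 <= #|H| -> path3 e (H :\: U) a b c ->
  exists x y z, path3 e (H :\: U) x y z /\ k + (#|outs e H z| + #|ins e H x|) <= #|H|.
Proof.
move=> irr f3 f4 UH k0 cU cH pabc; set R := H :\: U in pabc *.
have RH : R \subset H by rewrite subsetDl.
apply: NNPP => ngood.
have bad x y z : path3 e R x y z -> #|H| < k + (#|outs e H z| + #|ins e H x|).
  by move=> p; rewrite ltnNge; apply/negP=> ?; apply: ngood; exists x, y, z.
have /path3P[[ab ac bc] [aR bR cR eab ebc]] := pabc.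
have ltS := card_outs_le irr f3 f4 RH k0 bad bR cR ebc.
have ltT : #|ins e R a| < 2 * k.
  apply: (@card_outs_le V (revrel e) H R k b a) => //; [exact: free3_rev|exact: free4_rev|].
  by move=> x y z; rewrite path3_rev => /bad; rewrite [#|outs e H x| + _]addnC.
have pH : path3 e H a b c.
  by apply/path3P; rewrite ab ac bc !(subsetP RH).
have dis : #|(outs e H c :&: U) :&: (ins e H a :&: U)| = 0.
  apply/eqP; rewrite cards_eq0 -subset0; apply/subsetP=> z.
  move=> /setIP[/setIP[zc zU] /setIP[za _]].
  have := subsetP (free34_inter irr f3 f4 pH) z; rewrite in_setI zc za => /(_ erefl).
  by rewrite in_set1 => /eqP zb; move: bR; rewrite -zb inE zU.
have := cardsUI (outs e H c :&: U) (ins e H a :&: U); rewrite dis addn0.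
have : #|outs e H c :&: U :|: ins e H a :&: U| <= #|U|.
  by rewrite subset_leq_card // subUset !subsetIr.
have := bad a b c pabc.
rewrite -(cardsID U (outs e H c)) -(cardsID U (ins e H a)).
rewrite (_ : outs e H c :\: U = outs e R c); last by apply/setP=> z; rewrite !inE andbA.
rewrite (_ : ins e H a :\: U = ins e R a); last by apply/setP=> z; rewrite !inE andbA.
move: ltS ltT cU cH k0; clear; lia.
Qed.

(** * Degree counting and the closing of good paths *)

Lemma card_outsID (V : finType) (e : rel V) (A B : {set V}) (u : V) :
  #|outs e A u| = #|outs e (A :&: B) u| + #|outs e (A :\: B) u|.
Proof.
rewrite -(cardsID B (outs e A u)); congr (_ + _); apply: eq_card => x; rewrite !inE.
  by rewrite andbAC.
by rewrite andbA.
Qed.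

Lemma card_insID (V : finType) (e : rel V) (A B : {set V}) (u : V) :
  #|ins e A u| = #|ins e (A :&: B) u| + #|ins e (A :\: B) u|.
Proof. exact: (@card_outsID V (revrel e)). Qed.

Lemma card_outs_max (V : finType) (e : rel V) (A : {set V}) (u : V) : #|outs e A u| <= #|A|.
Proof. by apply/subset_leq_card/subsetP=> x; rewrite inE => /andP[]. Qed.

Lemma card_ins_max (V : finType) (e : rel V) (A : {set V}) (u : V) : #|ins e A u| <= #|A|.
Proof. exact: (card_outs_max (revrel e)). Qed.

Lemma card_common (V : finType) (e : rel V) (A : {set V}) (c a : V) (m : nat) :
  #|A| + m <= #|outs e A c| + #|ins e A a| -> m <= #|outs e A c :&: ins e A a|.
Proof.
have : #|outs e A c :|: ins e A a| <= #|A|.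
  by rewrite subset_leq_card // subUset; apply/andP; split; apply/subsetP=> x;
     rewrite inE => /andP[].
by rewrite -cardsUI; lia.
Qed.

Definition good_path (V : finType) (e : rel V) (H : {set V}) (k : nat) (s : seq V) : Prop :=
  exists a b c, [/\ s = [:: a; b; c], path3 e H a b c &
    k + (#|outs e H c| + #|ins e H a|) <= #|H|].

(** Distinctness of the vertices is supplied by the packing. *)
Definition short_cycle (V : finType) (e : rel V) (s : seq V) : Prop :=
  (size s = 3 \/ size s = 4) /\ cycle e s.

(** The bound [n + 2] becomes [n] because each endpoint loses its matching edge in the
    contraction. *)
Definition ore (V : finType) (e : rel V) : Prop :=
  forall u v, u != v -> ~~ e u v -> #|V| <= #|outs e setT u| + #|ins e setT v|.

(** The arc [c -> a] would give a 3-cycle, so [ore] applies; goodness then leaves at least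
    [#|W| + k] of the degree sum to [W]. *)
Lemma good_path_closes (V : finType) (e : rel V) (W : {set V}) (k : nat) (a b c : V) :
  ore e -> free3 e (~: W) -> path3 e (~: W) a b c ->
  k + (#|outs e (~: W) c| + #|ins e (~: W) a|) <= #|~: W| ->
  k <= #|outs e W c :&: ins e W a|.
Proof.
move=> oreE f3 /path3P[[ab ac bc] [aH bH cH eab ebc]] good; apply: card_common.
have nca : ~~ e c a by apply: f3 ebc.
have := oreE c a; rewrite eq_sym ac nca => /(_ isT isT).
rewrite (card_outsID e _ W) (card_insID e _ W) setTI setTD -(cardsC W).
move: good; clear; lia.
Qed.

Lemma path3_sub (V : finType) (e : rel V) (R H : {set V}) (a b c : V) :
  R \subset H -> path3 e R a b c -> path3 e H a b c.
Proof.
by move=> /subsetP RH /path3P[? [? ? ? ? ?]]; apply/path3P; split=> //; split=> //; apply: RH.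
Qed.

Lemma good_packing_closes (V : finType) (e : rel V) (W : {set V}) (k : nat)
    (L : seq (seq V)) :
  ore e -> free3 e (~: W) -> packing (good_path e (~: W) k) k L ->
  exists L', packing (short_cycle e) k L'.
Proof.
move=> oreE f3 pL; apply: (extend_packing (Z := W)) pL _ _.
  move=> s x [a [b [c [-> /path3P[_ [aH bH cH _ _]] _]]]].
  by rewrite !inE in aH bH cH *; case/or3P => /eqP->.
move=> s [a [b [c [-> p good]]]].
exists (outs e W c :&: ins e W a); split; last 1 first.
- move=> w; rewrite !inE => /andP[/andP[_ ecw] /andP[_ ewa]].
  have /path3P[_ [_ _ _ eab ebc]] := p.
  exists [:: w; a; b; c] => //; split; first by right.
  by rewrite /= ewa eab ebc ecw.
- by apply/subsetP=> w; rewrite !inE => /andP[/andP[]].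
- exact: good_path_closes p good.
Qed.

(** * The case of a remainder without three-vertex paths *)

(** If [c -> a] fails, then [c] has no out-neighbour and [a] no in-neighbour in the remainder. The
    degree sum must spill over [W] into a common vertex [x] of [U], giving the 3-cycle
    [a -> c -> x -> a]. *)
Lemma no_path3_sym (V : finType) (e : rel V) (W U : {set V}) (k : nat) :
  irreflexive e -> ore e -> free3 e (~: W) -> U \subset ~: W ->
  2 * #|W| + #|U| < #|V| ->
  (forall a b c, ~~ path3 e (~: W :\: U) a b c) ->
  {in ~: W :\: U &, forall a c, e a c -> e c a}.
Proof.
move=> irr oreE f3 UH lt_n nop a c aR cR eac; apply: contraT => nca.
have ac : a != c by apply: contraTneq eac => ->; rewrite irr.
have n0 : #|outs e (~: W :\: U) c| = 0.
  apply/eqP; rewrite cards_eq0 -subset0; apply/subsetP=> y; rewrite inE => /andP[yR ecy].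
  apply: contraR (nop a c y) => _; apply/path3P; split=> //; split=> //.
    by apply: contraTneq ecy => <-.
  by apply: contraTneq ecy => <-; rewrite irr.
have n1 : #|ins e (~: W :\: U) a| = 0.
  apply/eqP; rewrite cards_eq0 -subset0; apply/subsetP=> y; rewrite inE => /andP[yR eya].
  apply: contraR (nop y a c) => _; apply/path3P; split=> //; split=> //.
    by apply: contraTneq eya => ->; rewrite irr.
  by apply: contraTneq eya => ->.
have := oreE c a; rewrite eq_sym ac nca => /(_ isT isT).
rewrite (card_outsID e _ W) (card_insID e _ W) setTI setTD.
rewrite (card_outsID e (~: W) U) (card_insID e (~: W) U) (setIidPr UH) n0 n1 !addn0 => le_n.
have : 0 < #|outs e U c :&: ins e U a|.
  apply: card_common; move: (card_outs_max e W c) (card_ins_max e W a).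
  by move: le_n lt_n; clear; lia.
case/card_gt0P => x; rewrite !inE => /andP[/andP[xU ecx] /andP[_ exa]].
have aH : a \in ~: W by move: aR; rewrite inE => /andP[].
have cH : c \in ~: W by move: cR; rewrite inE => /andP[].
by have := f3 a c x aH cH (subsetP UH x xU) eac ecx; rewrite exa.
Qed.

Lemma no_path3_card (V : finType) (e : rel V) (R : {set V}) (u : V) :
  irreflexive e -> (forall a b c, ~~ path3 e R a b c) -> {in R &, forall a c, e a c -> e c a} ->
  u \in R -> #|outs e R u| <= 1 /\ #|ins e R u| <= 1.
Proof.
move=> irr nop sym uR.
have eqR : {in R &, forall y z, e u y -> e u z -> y = z}.
  move=> y z yR zR euy euz; apply/eqP; apply: contraR (nop y u z) => yz; apply/path3P.
  split; split=> //; last exact: sym.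
    by apply: contraTneq euy => ->; rewrite irr.
  by apply: contraTneq euz => ->; rewrite irr.
split; apply/card_le1_eqP => y z; rewrite !inE => /andP[yR ey] /andP[zR ez]; apply: eqR => //; exact: sym.
Qed.

Lemma no_path3_good_packing (V : finType) (e : rel V) (W U : {set V}) (k : nat) :
  irreflexive e -> ore e -> free3 e (~: W) -> free4 e (~: W) -> U \subset ~: W ->
  0 < k -> #|W| <= 4 * (k - 1) -> #|U| <= 3 * (k - 1) -> 12 * k - 9 <= #|V| ->
  (forall a b c, ~~ path3 e (~: W :\: U) a b c) ->
  exists L, packing (good_path e (~: W) k) k L.
Proof.
move=> irr oreE f3 f4 UH k0 cW cU cV nop; set H := ~: W in f3 f4 UH nop *; set R := H :\: U in nop.
have RH : R \subset H by rewrite subsetDl.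
have cH : #|W| + #|H| = #|V| by rewrite cardsC.
have cR : #|U| + #|R| = #|H| by rewrite -(cardsID U H) (setIidPr UH).
have sym : {in R &, forall a c, e a c -> e c a}.
  by apply: no_path3_sym nop => //; move: cW cU cV k0; clear; lia.
have deg1 u : u \in R -> #|outs e R u| <= 1 /\ #|ins e R u| <= 1.
  exact: no_path3_card.
pose pair s := exists u v, [/\ s = [:: u; v], u != v, u \in R, v \in R & ~~ e u v].
have [L pL] : exists L, packing pair k L.
  apply: greedy_packing => j L jk pL.
  have cL : #|[set x in flatten L]| <= 2 * j.
    by apply: size_flatten_packing pL _ => s [u [v [-> _ _ _ _]]].
  (* [R] has at least [5 * k - 2] vertices and at most [2 * (k - 1)] are used. Of three free ones,
     [x -> y -> z] is not a path, so one of its steps is a non-arc. *)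
  have /card_gt2P[x [y [z [[xR yR zR] [xy yz zx]]]]] : 2 < #|R :\: [set x in flatten L]|.
    move: (cardsID [set x in flatten L] R) (subset_leq_card (subsetIr R [set x in flatten L])).
    by move: cL cH cR cW cU cV jk k0; clear; lia.
  move: xR yR zR => /setDP[xR xL] /setDP[yR yL] /setDP[zR zL].
  rewrite !inE in xL yL zL.
  have pairs u v : u != v -> u \notin flatten L -> v \notin flatten L -> u \in R -> v \in R ->
      ~~ e u v -> exists s, [/\ pair s, uniq s & forall x, x \in s -> x \notin flatten L].
    move=> uv uL vL uR vR nuv; exists [:: u; v]; split; first by exists u, v.
      by rewrite /= inE uv.
    by move=> w; rewrite !inE => /orP[] /eqP->.
  case: (boolP (e x y)) => [exy|]; last exact: pairs.
  case: (boolP (e y z)) => [eyz|]; last exact: pairs.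
  case/negP: (nop x y z); apply/path3P; split; split=> //.
  by rewrite eq_sym.
apply: (extend_packing (Z := U)) pL _ _.
  move=> s x [u [v [-> _ uR vR _]]]; rewrite !inE => /orP[] /eqP->.
    by move: uR; rewrite inE => /andP[].
  by move: vR; rewrite inE => /andP[].
move=> s [u [v [-> uv uR vR nuv]]].
have [du _] := deg1 u uR; have [_ dv] := deg1 v vR.
have [dv' _] := deg1 v vR; have [_ du'] := deg1 u uR.
exists (outs e U u :&: ins e U v); split.
- by apply/subsetP=> w; rewrite !inE => /andP[/andP[]].
(* [W] absorbs at most [8 * (k - 1)] of the degree sum and [R] at most 2, which leaves
   [4 * k - 3 >= #|U| + k]; here [12 * k - 9] is used in full. *)
- apply: card_common; have := oreE u v uv nuv.
  rewrite (card_outsID e _ W) (card_insID e _ W) setTI setTD -/H.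
  rewrite (card_outsID e H U) (card_insID e H U) (setIidPr UH) -/R.
  move: (card_outs_max e W u) (card_ins_max e W v) du dv cW cU cV k0; clear; lia.
- move=> x; rewrite !inE => /andP[/andP[xU eux] /andP[_ exv]].
  exists [:: u; x; v]; first by rewrite (perm_catCA [:: u] [:: x] [:: v]).
  have p : path3 e H u x v.
    apply/path3P; split; split; rewrite ?(subsetP RH u) ?(subsetP RH v) ?(subsetP UH x) //.
      by apply: contraTneq eux => ->; rewrite irr.
    by apply: contraTneq exv => ->; rewrite irr.
  exists u, x, v; split=> //.
  (* A nonempty [U] forces [k >= 2], so that [k + 3 <= #|R|]; the degree sum within [H] is at most
     [#|U| + 3]. *)
  have U0 : 0 < #|U| by apply/card_gt0P; exists x.
  have := subset_leq_card (free34_inter irr f3 f4 p); rewrite cards1.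
  have : #|outs e U v :&: ins e U u| <= #|outs e H v :&: ins e H u|.
    apply/subset_leq_card/subsetP=> z; rewrite !inE => /andP[/andP[zU evz] /andP[_ ezu]].
    by have := subsetP UH z zU; rewrite inE evz ezu => ->.
  have := @card_common V e U v u (#|outs e U v| + #|ins e U u| - #|U|).
  rewrite (card_outsID e H U) (card_insID e H U) (setIidPr UH) -/R.
  move: dv' du' cW cU cV cH cR k0 U0; clear; lia.
Qed.

(** * Disjoint 3- and 4-cycles in the digraph *)

Lemma digraph_short_cycles (V : finType) (e : rel V) (k : nat) :
  irreflexive e -> ore e -> 0 < k -> 12 * k - 9 <= #|V| ->
  exists L, packing (short_cycle e) k L.
Proof.
move=> irr oreE k0 cV.
case: (maximal_packing (short_cycle e) k) => [//|[j [C [jk pC maxC]]]].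
pose W := [set x in flatten C].
have cW : #|W| <= 4 * (k - 1).
  apply: (@leq_trans (4 * j)); last by lia.
  by apply: size_flatten_packing pC _ => s [[]->].
have noC s : short_cycle e s -> uniq s -> {subset s <= ~: W} -> False.
  by move=> cs us sH; have [x /sH] := maxC s cs us; rewrite !inE => /negP.
have f3 : free3 e (~: W).
  move=> a b c aH bH cH eab ebc; apply/negP=> eca; apply: (noC [:: a; b; c]).
  - by split; [left | rewrite /= eab ebc eca].
  - rewrite /= !inE negb_or andbT -andbA; apply/and3P; split.
    + by apply: contraTneq eab => ->; rewrite irr.
    + by apply: contraTneq eca => ->; rewrite irr.
    + by apply: contraTneq ebc => ->; rewrite irr.
  - by move=> x; rewrite !in_cons orbF => /or3P[] /eqP->.
have f4 : free4 e (~: W).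
  move=> a b c d aH bH cH dH ac bd eab ebc ecd; apply/negP=> eda.
  apply: (noC [:: a; b; c; d]).
  - by split; [right | rewrite /= eab ebc ecd eda].
  - rewrite /= !inE !negb_or ac bd !andbT /=; apply/and3P; split.
    + apply/andP; split; first by apply: contraTneq eab => ->; rewrite irr.
      by apply: contraTneq eda => ->; rewrite irr.
    + by apply: contraTneq ebc => ->; rewrite irr.
    + by apply: contraTneq ecd => ->; rewrite irr.
  - by move=> x; rewrite !in_cons orbF => /or4P[] /eqP->.
suff [L] : exists L, packing (good_path e (~: W) k) k L by apply: good_packing_closes.
case: (maximal_packing (good_path e (~: W) k) k) => [//|[i [L [ik pL maxL]]]].
pose U := [set x in flatten L].
have cU : #|U| <= 3 * (k - 1).
  apply: (@leq_trans (3 * i)); last by lia.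
  by apply: size_flatten_packing pL _ => s [a [b [c [->]]]].
have UH : U \subset ~: W.
  case: pL => _ PL _; apply/subsetP=> x; rewrite inE => /flattenP[s /PL[a [b [c [-> p _]]]]].
  by have /path3P[_ [aH bH cH _ _]] := p; rewrite !in_cons orbF => /or3P[] /eqP->.
apply: (no_path3_good_packing irr oreE f3 f4 UH k0 cW cU cV) => a b c; apply/negP=> pabc.
have cH : 8 * k - 5 <= #|~: W| by have := cardsC W; lia.
have [x [y [z [p good]]]] := exists_good_path3 irr f3 f4 UH k0 cU cH pabc.
have pH := path3_sub (subsetDl _ _) p.
have gp : good_path e (~: W) k [:: x; y; z] by exists x, y, z.
have /and4P[uxyz _ _ _] := p.
have [w + wL] := maxL _ gp uxyz.
have /path3P[_ [xR yR zR _ _]] := p.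
by rewrite !in_cons orbF => /or3P[] /eqP w_eq; [move: xR|move: yR|move: zR]; rewrite -w_eq !inE wL.
Qed.

(** * Transfer from the digraph to the bipartite graph *)

Lemma map_next_uniq (T : eqType) (c : seq T) : uniq c -> map (next c) c = rot 1 c.
Proof.
case: c => [//|x c] uc; apply: (@eq_from_nth _ x); first by rewrite size_map size_rot.
move=> i; rewrite size_map => ic; rewrite (nth_map x) // next_nth mem_nth // index_uniq //.
move: ic; rewrite rot1_cons nth_rcons /= ltnS leq_eqVlt => /predU1P[->|ic].
  by rewrite ltnn eqxx nth_default.
by rewrite ic; apply: set_nth_default.
Qed.

(** With [next] replaced by a rotation, the edges of an explicit cycle are found by computation. *)
Lemma cycle_edges_rot (T : finType) (c : seq T) : uniq c ->
  cycle_edges c = [seq [set p.1; p.2] | p <- zip c (rot 1 c)].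
Proof.
move=> uc; rewrite /cycle_edges -map_next_uniq //.
by move: (next c) => f; elim: c {uc} => //= x c ->.
Qed.

Lemma perfect_matching_mate (T : finType) (e : rel T) (M : {set {set T}}) :
  simple_graph e -> perfect_matching e M ->
  exists m : T -> T, (forall x y, ([set x; y] \in M) = (y == m x)) /\ forall x, e x (m x).
Proof.
move=> [sym irr] [edgeM oneM].
have mate x : exists y, [set x; y] \in M.
  have /eqP/cards1P[A eqA] := oneM x.
  have : A \in [set A in M | x \in A] by rewrite eqA set11.
  rewrite inE => /andP[AM]; have [a [b [_ eqAab]]] := edgeM A AM.
  rewrite eqAab in AM *; rewrite !inE => /orP[] /eqP->; first by exists b.
  by exists a; rewrite setUC.
have inj x y z : [set x; y] \in M -> [set x; z] \in M -> y = z.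
  move=> yM zM; have /eqP/cards1P[A eqA] := oneM x.
  have AE B : B \in M -> x \in B -> B = A.
    by move=> BM xB; apply/set1P; rewrite -eqA inE BM.
  have eqyz : [set x; y] = [set x; z] by rewrite (AE _ yM (set21 _ _)) (AE _ zM (set21 _ _)).
  (* Irreflexivity rules out degenerate edges, so an edge and one end determine the other end. *)
  have ne w : [set x; w] \in M -> w != x.
    move=> /edgeM[a [b [eab eqx]]]; apply: contraTneq eab => wx.
    have : a \in [set x; w] by rewrite eqx set21.
    have : b \in [set x; w] by rewrite eqx set22.
    by rewrite wx !inE !orbb => /eqP-> /eqP->; rewrite irr.
  have : y \in [set x; z] by rewrite -eqyz set22.
  by rewrite !inE (negPf (ne y yM)) => /eqP.
exists (fun x => xchoose (mate x)); split=> x => [y|].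
  apply/idP/eqP => [yM|->]; last exact: (xchooseP (mate x)).
  exact: inj yM (xchooseP (mate x)).
have /edgeM[a [b [eab eqx]]] := xchooseP (mate x).
move: (xchoose _) eqx => y eqx.
have : a \in [set x; y] by rewrite eqx set21.
have : b \in [set x; y] by rewrite eqx set22.
have : y \in [set a; b] by rewrite -eqx set22.
have : x \in [set a; b] by rewrite -eqx set21.
rewrite !inE => /orP[]/eqP-> /orP[]/eqP-> // ; rewrite ?orbb ?[e b a]sym //.
- by move=> /eqP eba; rewrite eba irr in eab.
- by move=> _ /eqP eba; rewrite eba irr in eab.
Qed.

Lemma uniq_flatten (T : eqType) (L : seq (seq T)) : uniq (flatten L) ->
  (forall s, s \in L -> uniq s) /\
  forall i j x, x \in nth [::] L i -> x \in nth [::] L j -> i = j.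
Proof.
elim: L => [|s L IHL] /=; first by split=> // i j x; rewrite nth_nil.
rewrite cat_uniq => /and3P[us /hasPn dsL /IHL[uL dL]].
have ds x j : x \in s -> x \notin nth [::] L j.
  move=> xs; case: (ltnP j (size L)) => jL; last by rewrite nth_default.
  apply: contraTN xs => xj; apply: dsL; apply/flattenP.
  by exists (nth [::] L j) => //; apply: mem_nth.
split=> [t /predU1P[->|/uL]|[|i] [|j] x //=] //.
- by move=> /(ds x j)/negPf->.
- by move=> xi /(ds x i); rewrite xi.
- by move=> xi xj; rewrite (dL i j x).
Qed.

(* Loops are excluded: they would correspond to the edges of [M]. *)
Definition contracted_arc (T : finType) (e : rel T) (m : T -> T) (X : {set T}) :
    rel {x | x \in X} :=
  fun u v => (u != v) && e (val u) (m (val v)).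

(** The mate comes first because an arc [u -> v] is the edge from [val u] to [m (val v)]: blocks are
    matching edges, and arcs join consecutive blocks. *)
Definition expand (T : finType) (m : T -> T) (X : {set T}) (s : seq {x | x \in X}) : seq T :=
  flatten [seq [:: m (val u); val u] | u <- s].

Theorem theorem3 (k n : nat) (T : finType) (e : rel T) (X : {set T})
    (M : {set {set T}}) :
  0 < k ->
  simple_graph e ->
  bipartite_with e X ->
  #|T| = 2 * n -> #|X| = n ->
  perfect_matching e M ->
  12 * k - 9 <= n ->
  sigma11_ge e X (n + 2) ->
  exists C : 'I_k -> seq T,
    (forall i, M_cycle e M (C i) /\ (size (C i) = 6 \/ size (C i) = 8)) /\
    (forall i j, i != j -> [disjoint C i & C j]).
Proof.
move=> k0 eG bip cT cX pm le_n sigma.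
have [sym irr] := eG; have [m [mM em]] := perfect_matching_mate eG pm.
have mm x : m (m x) = x by apply/esym/eqP; rewrite -mM setUC mM.
have minj : injective m := can_inj mm.
have mX x : (m x \in X) = (x \notin X) by have := bip x (m x) (em x); case: (x \in X); case: (m x \in X).
pose V : finType := {x | x \in X}; pose D : rel V := contracted_arc e m (X := X).
have irrD : irreflexive D by move=> u; rewrite /D /contracted_arc eqxx.
have cV : #|V| = n by rewrite card_sig -cX; apply: eq_card => x; rewrite inE.
have oreD : ore D.
  move=> u v uv; rewrite /D /contracted_arc uv /= => nuv.
  have := sigma (val u) (m (val v)) (valP u); rewrite mX (valP v) => /(_ isT nuv).
  suff [-> ->] : deg e (val u) = #|outs D setT u|.+1 /\ deg e (m (val v)) = #|ins D setT v|.+1.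
    by rewrite cV addn2 addSn addnS !ltnS.
  split.
    rewrite /deg (cardsD1 (m (val u))) inE em add1n; congr _.+1.
    rewrite -(card_imset _ (inj_comp minj val_inj)); apply: eq_card => y; rewrite !inE.
    apply/andP/imsetP => [[ym euy]|[w]].
      have yX : m y \in X by rewrite mX; have := bip _ _ euy; rewrite (valP u) => <-.
      exists (Sub (m y) yX); last by rewrite /= mm.
      rewrite !inE /D /contracted_arc /= mm euy andbT -val_eqE /=.
      by apply: contra_neq ym => /(congr1 m); rewrite mm => ->.
    rewrite !inE /D /contracted_arc /= => /andP[uw euw] -> /=; split=> //.
    by rewrite (inj_eq minj) (inj_eq val_inj) eq_sym.
  rewrite /deg (cardsD1 (val v)) inE [e _ _]sym em add1n; congr _.+1.
  rewrite -(card_imset _ val_inj); apply: eq_card => y; rewrite !inE.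
  apply/andP/imsetP => [[yv evy]|[w]].
    have yX : y \in X by have := bip _ _ evy; rewrite mX (valP v) /=; case: (y \in X).
    exists (Sub y yX) => //.
    by rewrite !inE /D /contracted_arc /= sym evy -val_eqE yv.
  rewrite !inE /D /contracted_arc /= => /andP[uw euw] -> /=; split; last by rewrite sym.
  by rewrite (inj_eq val_inj).
have cVk : 12 * k - 9 <= #|V| by rewrite cV.
have [L [zL PL uL]] := digraph_short_cycles irrD oreD k0 cVk.
have [uLs dL] := uniq_flatten uL.
have memE (s : seq V) x : (x \in expand m s) = (x \in map val s) || (m x \in map val s).
  have eqm u : (m x == u) = (x == m u) by rewrite -{1}[u]mm (inj_eq minj).
  elim: s => //= u s IHs; rewrite !inE IHs eqm -!orbA orbCA; congr (_ || _).
  exact: orbCA.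
have uE (s : seq V) : uniq s -> uniq (expand m s).
  elim: s => //= u s IHs /andP[us /IHs uEs]; rewrite -/(expand m s) uEs !inE !memE mm.
  have nX (w : V) : m (val w) \notin map val s.
    by apply/mapP => -[w' _ eqw]; have := valP w'; rewrite -eqw mX (valP w).
  rewrite (negPf (nX u)) /= !(mem_map val_inj) (negPf us) /= !orbF !andbT.
  by apply/eqP => eqm; have := mX (val u); rewrite /= eqm (valP u).
exists (fun i => expand m (nth [::] L i)); split=> [i|i j ij].
  set s := nth _ L i; have sL : s \in L by rewrite mem_nth ?zL.
  have us : uniq s := uLs s sL.
  have [zs cs] := PL s sL; have uEs := uE s us.
  have zE : size (expand m s) = 2 * size s by elim: (s) => //= u t; rewrite mulnS => ->.
  split; last by rewrite zE; case: zs => ->; [left | right].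
  have cyc : cycle e (expand m s) /\
      count (fun A => A \in M) [seq [set p.1; p.2] | p <- zip (expand m s) (rot 1 (expand m s))]
        = size s.
    (* Arcs join distinct [u] and [v], so their edges lie outside [M]; only the edge of each block
       is counted. *)
    have arc u v : D u v -> e (val u) (m (val v)) /\ ([set val u; m (val v)] \in M) = false.
      move=> /andP[uv euv]; split=> //; rewrite mM (inj_eq minj).
      by rewrite val_eqE eq_sym (negPf uv).
    have em' u : e (m u) u by rewrite sym.
    have Mm u : [set m u; u] \in M by rewrite mM mm.
    case: zs => zs; move: zs cs; clearbody s.
      case: s {sL us uEs zE} => [|a [|b [|c []]]] //= _.
      case/and4P=> /arc[ab abM] /arc[bc bcM] /arc[ca caM] _.
      by rewrite !em' ab bc ca !Mm abM bcM caM.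
    case: s {sL us uEs zE} => [|a [|b [|c [|d []]]]] //= _.
    case/and5P=> /arc[ab abM] /arc[bc bcM] /arc[cd cdM] /arc[da daM] _.
    by rewrite !em' ab bc cd da !Mm abM bcM cdM daM.
  have [cE nE] := cyc; split; last by rewrite cycle_edges_rot // nE zE mulKn.
  split=> //; split=> //; rewrite zE; case: zs => -> //.
set s := nth _ L i; set t := nth _ L j.
have dst x : x \in map val s -> x \notin map val t.
  case/mapP=> u us ->; rewrite (mem_map val_inj); apply: contra ij => ut.
  by apply/eqP/val_inj/(dL i j u).
have mval (r : seq V) x : x \in map val r -> x \in X by case/mapP=> u _ ->; apply: valP.
rewrite disjoint_subset; apply/subsetP=> x; rewrite !inE !memE negb_or.
case/orP=> [xs|mxs]; [rewrite (dst x xs) | rewrite (dst (m x) mxs) andbT].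
  by apply/negP => /mval; rewrite mX (mval _ _ xs).
by apply/negP => /mval xX; have := mval _ _ mxs; rewrite mX xX.
Qed.
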